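(* Let $X_1=X_2=X_3=[0,1]$, let each $\mu_{ij}$ be Lebesgue measure on $[0,1]^2$, and $c(x_1,x_2,x_3)=x_1x_2x_3$. Then there exists exactly one probability measure $\pi$ on $[0,1]^3$ with $\mathrm{Pr}_{ij}(\pi)=\mu_{ij}$ for all $1\le i<j\le3$ minimizing $\int x_1x_2x_3\,d\pi$ among all such measures, and its support equals the Sierpiński tetrahedron $S$.
   Context: $\mathrm{Pr}_{ij}$ is the projection of $[0,1]^3$ onto coordinates $(i,j)$. The Sierpiński tetrahedron $S\subseteq[0,1]^3$ is the set of points $(x_1,x_2,x_3)$ for which there exist binary expansions $x_i=\sum_{k\ge1}x_{i,k}2^{-k}$, $x_{i,k}\in\{0,1\}$, such that $x_{1,k}+x_{2,k}+x_{3,k}\equiv0\pmod 2$ for all $k\ge1$. (Equivalently $S=\bigcap_{n\ge1}J_n$ where $J_n$ is the union of the cubes $\prod_{i=1}^3[a_i2^{-n},(a_i+1)2^{-n}]$ over integers $0\le a_i<2^n$ whose bitwise XOR $a_1\oplus a_2\oplus a_3$ is $0$.) *)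

(* Defs.v *)
From HB Require Import structures.
From mathcomp Require Import all_boot all_order all_algebra.
From mathcomp Require Import all_classical all_reals all_analysis.
Set Implicit Arguments. Unset Strict Implicit. Unset Printing Implicit Defensive.
Import Order.TTheory GRing.Theory Num.Theory.
Import numFieldNormedType.Exports.
Local Open Scope classical_set_scope.
Local Open Scope ring_scope.

(* Points of R^3 are represented as ((x1, x2), x3) : (R * R) * R,
   with the product sigma-algebra (= Borel sigma-algebra of R^3)
   and the product topology. *)
Section Defs.
Variable R : realType.
Notation T3 := ((R * R) * R)%type.

Definition x1 (x : T3) : R := x.1.1.
Definition x2 (x : T3) : R := x.1.2.
Definition x3 (x : T3) : R := x.2.

Definition Pr12 (x : T3) : R * R := (x1 x, x2 x).
Definition Pr13 (x : T3) : R * R := (x1 x, x3 x).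
Definition Pr23 (x : T3) : R * R := (x2 x, x3 x).

Definition unit_square : set (R * R) := `[0%R, 1%R] `*` `[0%R, 1%R].
Definition unit_cube : set T3 := unit_square `*` `[0%R, 1%R].

Definition leb_square (A : set (R * R)) : \bar R :=
  ((@lebesgue_measure R) \x (@lebesgue_measure R))%E (A `&` unit_square).

Definition admissible (pi : probability T3 R) : Prop :=
  pi unit_cube = 1%E /\
  forall A : set (R * R), measurable A ->
    [/\ pi (Pr12 @^-1` A) = leb_square A,
        pi (Pr13 @^-1` A) = leb_square A &
        pi (Pr23 @^-1` A) = leb_square A].

Definition cost (x : T3) : R := x1 x * x2 x * x3 x.

Definition total_cost (pi : probability T3 R) : \bar R :=
  (\int[pi]_x (cost x)%:E)%E.

Definition minimizer (pi : probability T3 R) : Prop :=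
  admissible pi /\
  forall pi' : probability T3 R, admissible pi' ->
    (total_cost pi <= total_cost pi')%E.

Definition measure_support (pi : probability T3 R) : set T3 :=
  [set x | forall U : set T3, open U -> U x -> (0 < pi U)%E].

(* b is a binary expansion of t : t = sum_{k>=1} b_k 2^{-k}
   (digit b_k is stored at index k-1) *)
Definition binary_expansion (b : nat -> bool) (t : R) : Prop :=
  (fun n : nat => \sum_(0 <= k < n) (b k)%:R / 2%:R ^+ k.+1) @ \oo --> t.

Definition sierpinski_tetrahedron : set T3 :=
  [set x | exists b1 b2 b3 : nat -> bool,
     [/\ binary_expansion b1 (x1 x), binary_expansion b2 (x2 x),
         binary_expansion b3 (x3 x) &
         forall k : nat, (b1 k (+) b2 k (+) b3 k) = false]].
End Defs.

(* Main.v *)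
Require Import Defs.
From HB Require Import structures.
From mathcomp Require Import all_boot all_order all_algebra.
From mathcomp Require Import all_classical all_reals all_analysis.
From mathcomp Require Import measurable_realfun ring lra.
Import Order.TTheory GRing.Theory Num.Theory.
Import numFieldNormedType.Exports.
Local Open Scope classical_set_scope.
Local Open Scope ring_scope.

Set Implicit Arguments.
Unset Strict Implicit.
Unset Printing Implicit Defensive.

(** In the centered coordinates [a_i = 1 - 2 x_i] the cost is, up to functions of
    two coordinates, [- a_1 a_2 a_3 / 8].  With the tent map [tau a = 2 |a| - 1] one
    has [|a_1 a_2 a_3| = \prod_i (1 + tau a_i) / 8], and expanding this product
    leaves, modulo functions of two coordinates, only [\prod_i tau a_i / 8].  Iterating,
    [- a_1 a_2 a_3] is a sum of functions of two coordinates plus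
    [\sum_(k < n) (|p_k| - p_k) / 8^k + (1 - p_n) / 8^n] with
    [p_k = \prod_i tau^k a_i].  Hence, as soon as some admissible measure satisfies
    [p_k >= 0] almost surely for all [k], the minimizers are exactly the
    measures with this property, and it characterizes the points of the
    tetrahedron.  Such a measure is the image of Lebesgue measure under
    [(x, y) |-> (x, y, x xor y)]; it is admissible because [y |-> x xor y]
    preserves Lebesgue measure.  Finally, if [x] and [y] are not dyadic then
    [z = x xor y] is the only point of the tetrahedron above [(x, y)], so the
    minimizer is unique. *)

(** * A dual certificate self-similar under the tent map *)

Section Dual.
Variable R : realType.
Implicit Types a b c x y z : R.

Definition tau a : R := 2 * `|a| - 1.

Definition tri k a b c : R := iter k tau a * iter k tau b * iter k tau c.

(* [dual n] is even in [a] and in [b]; this makes its self-similar definition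
   consistent at the dyadic points, where two digit choices are possible. *)
Fixpoint dual n a b : R :=
  if n is m.+1 then
    (- 1 / 3 - (tau a + tau b) / 2 - tau a * tau b + dual m (tau a) (tau b)) / 8
  else - 1 / 3.

(** The slack of the certificate. Unrolled, it is [\sum_(k < n) (|p_k| - p_k) / 8^k + (1 - p_n) /
    8^n] with [p_k = tri k a b c]. *)
Fixpoint gap n a b c : R :=
  if n is m.+1 then
    `|a * b * c| - a * b * c + gap m (tau a) (tau b) (tau c) / 8
  else 1 - a * b * c.

(** Write [- abc] as [(|abc| - abc) - |abc|] and expand [|abc|]. Each pair takes a third of the
    constant, half of its two linear terms (a variable lies in two pairs) and its own product; the
    leftover triple product is the induction hypothesis. *)
Lemma dual_gap n a b c :
  - (a * b * c) = dual n a b + dual n a c + dual n b c + gap n a b c.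
Proof.
elim: n a b c => [|n IH] a b c /=; first by lra.
have := IH (tau a) (tau b) (tau c).
have -> : `|a * b * c| = (1 + tau a) / 2 * ((1 + tau b) / 2) * ((1 + tau c) / 2).
  by rewrite !normrM /tau; field.
by move=> H; lra.
Qed.

Lemma tau_itv a : -1 <= a <= 1 -> -1 <= tau a <= 1.
Proof.
move=> /andP[a1 a2]; have := normr_ge0 a.
have : `|a| <= 1 by rewrite ler_norml a1.
by rewrite /tau => *; apply/andP; split; lra.
Qed.

Lemma tri_le1 a b c : -1 <= a <= 1 -> -1 <= b <= 1 -> -1 <= c <= 1 ->
  `|a * b * c| <= 1.
Proof. by rewrite -!ler_norml !normrM => ? ? ?; rewrite !mulr_ile1 ?mulr_ge0. Qed.

Lemma gap_ge0 n a b c : -1 <= a <= 1 -> -1 <= b <= 1 -> -1 <= c <= 1 ->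
  0 <= gap n a b c.
Proof.
elim: n a b c => [|n IH] a b c a1 b1 c1 /=.
  by have := tri_le1 a1 b1 c1; have := ler_norm (a * b * c); lra.
have := IH _ _ _ (tau_itv a1) (tau_itv b1) (tau_itv c1).
by have := ler_norm (a * b * c); lra.
Qed.

(** The recursion preserves the bound since [2 + 3 / 8 <= 3]. Being uniform, it yields integrability
    of the slack. *)
Lemma gap_le3 n a b c : -1 <= a <= 1 -> -1 <= b <= 1 -> -1 <= c <= 1 ->
  `|gap n a b c| <= 3.
Proof.
move=> a1 b1 c1; rewrite ger0_norm ?gap_ge0//.
elim: n a b c a1 b1 c1 => [|n IH] a b c a1 b1 c1 /=.
  by have := tri_le1 a1 b1 c1; rewrite ler_norml => /andP[]; lra.
have := IH _ _ _ (tau_itv a1) (tau_itv b1) (tau_itv c1).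
by have := tri_le1 a1 b1 c1; have := ler_norm (- (a * b * c)); rewrite normrN; lra.
Qed.

(** The unrolled slack is a sum of nonnegative terms, so it dominates its [k]-th one. *)
Lemma tri_le_gap n k a b c : -1 <= a <= 1 -> -1 <= b <= 1 -> -1 <= c <= 1 ->
  (k < n)%N -> (`|tri k a b c| - tri k a b c) / 8 ^+ k <= gap n a b c.
Proof.
rewrite /tri.
elim: n k a b c => [//|n IH] k a b c a1 b1 c1; case: k => [_|k kn].
  rewrite /= expr0 divr1 lerDl.
  by rewrite divr_ge0// gap_ge0 ?tau_itv.
have := IH _ _ _ _ (tau_itv a1) (tau_itv b1) (tau_itv c1) kn.
rewrite !iterSr [gap n.+1 _ _ _]/= exprS invfM mulrCA.
by move: (_ / 8 ^+ k) => t; have := ler_norm (a * b * c); lra.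
Qed.

(** All the differences [|p_k| - p_k] vanish; only the remainder [(1 - p_n) / 8^n] is left. *)
Lemma gap_le n a b c : -1 <= a <= 1 -> -1 <= b <= 1 -> -1 <= c <= 1 ->
  (forall k, 0 <= tri k a b c) -> gap n a b c <= 1 / 8 ^+ n.
Proof.
elim: n a b c => [|n IH] a b c a1 b1 c1 tri0 /=.
  by have := tri0 0%N; rewrite /tri/=; lra.
have := IH _ _ _ (tau_itv a1) (tau_itv b1) (tau_itv c1).
rewrite exprS invfM ger0_norm; last exact: (tri0 0%N).
suff H k : 0 <= tri k (tau a) (tau b) (tau c) by move=> /(_ H); lra.
by have := tri0 k.+1; rewrite /tri !iterSr.
Qed.

Lemma tauM_sign (s : bool) a : tau ((-1) ^+ s * a) = tau a.
Proof. by rewrite /tau normrM normr_sign mul1r. Qed.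

(** An even number of sign changes cancels at level 0; at higher levels [tau] erases every sign. *)
Lemma tri_sign k (s1 s2 s3 : bool) a b c : s1 (+) s2 (+) s3 = false ->
  tri k ((-1) ^+ s1 * a) ((-1) ^+ s2 * b) ((-1) ^+ s3 * c) = tri k a b c.
Proof.
move=> s; rewrite /tri; case: k => [|k]; last by rewrite !iterSr !tauM_sign.
by case: s1 s2 s3 s => [] [] []//= _; rewrite ?expr0 ?expr1; ring.
Qed.

(** The tent map removes the leading digit [d] and reflects the tail when [d] is 1. *)
Lemma tau_digit (d : bool) t : 0 <= t <= 1 ->
  tau (1 - 2 * ((d%:R + t) / 2)) = (-1) ^+ d * (1 - 2 * t).
Proof.
move=> /andP[t0 t1]; rewrite /tau; case: d => /=; rewrite ?expr1 ?expr0.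
  by rewrite ler0_norm; lra.
by rewrite ger0_norm; lra.
Qed.

(** Passes to the limit in estimates that hold at every depth [n] of a recursion. *)
Lemma geometric_bound_eq0 (e C : R) : (forall n : nat, e <= C / 2 ^+ n) -> e <= 0.
Proof.
move=> H.
have : (fun n => C * geometric 1 2^-1 n) @ \oo --> (C * 0).
  apply: cvgMl_tmp; apply: cvg_geometric.
  by rewrite ger0_norm; lra.
rewrite mulr0 => h; apply: (ler_cvg_to (cvg_cst e) h).
by apply: nearW => n; rewrite /= mul1r exprVn.
Qed.

End Dual.

(** * Binary digits *)

Section Digits.
Variable R : realType.
Implicit Types (x y t : R) (b : nat -> bool).

Definition bsum b (n : nat) : R := \sum_(0 <= k < n) (b k)%:R / 2%:R ^+ k.+1.

Definition bval b : R := limn (bsum b).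

Lemma bsumS b n : bsum b n.+1 = ((b 0)%:R + bsum (b \o S) n) / 2.
Proof.
rewrite /bsum big_nat_recl// expr1 mulrDl mulr_suml; congr (_ + _).
by apply: eq_bigr => k _; rewrite [in LHS]exprS invfM mulrCA mulrC.
Qed.

Lemma bsum_itv b n : 0 <= bsum b n <= 1.
Proof.
elim: n b => [|n IH] b; first by rewrite /bsum big_geq// lexx ler01.
rewrite bsumS; have /andP[? ?] := IH (b \o S).
by case: (b 0) => /=; apply/andP; split; lra.
Qed.

Lemma bsum_cvg b : bsum b @ \oo --> bval b.
Proof.
apply: nondecreasing_is_cvgn.
  apply/nondecreasing_seqP => n; rewrite /bsum big_nat_recr//= lerDl.
  by rewrite divr_ge0// exprn_ge0.
by exists 1 => _ [n _ <-]; have /andP[] := bsum_itv b n.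
Qed.

Lemma binary_expansionP b t : binary_expansion b t <-> t = bval b.
Proof.
split=> [bt|->]; last exact: bsum_cvg.
by apply: (cvg_unique _ bt (@bsum_cvg b)).
Qed.

Lemma bval_itv b : 0 <= bval b <= 1.
Proof.
apply/andP; split.
  apply: limr_ge; first by apply/cvg_ex; eexists; exact: bsum_cvg.
  by apply: nearW => n; have /andP[] := bsum_itv b n.
apply: limr_le; first by apply/cvg_ex; eexists; exact: bsum_cvg.
by apply: nearW => n; have /andP[] := bsum_itv b n.
Qed.

Lemma bvalS b : bval b = ((b 0)%:R + bval (b \o S)) / 2.
Proof.
have h1 : (fun n => bsum b n.+1) @ \oo --> bval b.
  by have := @bsum_cvg b; rewrite -(cvg_shiftS (bsum b)).
have h2 : (fun n => bsum b n.+1) @ \oo --> ((b 0)%:R + bval (b \o S)) / 2.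
  rewrite (eq_fun (bsumS b)).
  by apply: cvgMr_tmp; apply: cvgD; [exact: cvg_cst|exact: bsum_cvg].
exact: (cvg_unique _ h1 h2).
Qed.

Lemma bval_close n b b' : (forall k, (k < n)%N -> b k = b' k) ->
  `|bval b - bval b'| <= 1 / 2 ^+ n.
Proof.
elim: n b b' => [|n IH] b b' bb'.
  have /andP[? ?] := bval_itv b; have /andP[? ?] := bval_itv b'.
  by rewrite expr0 divr1 ler_norml; apply/andP; split; lra.
rewrite (bvalS b) (bvalS b') bb'//.
have := IH (b \o S) (b' \o S) (fun k kn => bb' k.+1 kn).
rewrite exprS invfM; move: (2 ^- n) => r; rewrite !ler_norml => /andP[? ?].
by apply/andP; split; lra.
Qed.

(** Both sides obey the same halving recursion, so they differ by at most [2^-n] for every [n]. Any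
    digits compatible with the recursion are allowed, which leaves the choice open at dyadic
    points. *)
Lemma bval_unfold (t : nat -> R) b : (forall k, 0 <= t k <= 1) ->
  (forall k, t k = ((b k)%:R + t k.+1) / 2) -> t 0 = bval b.
Proof.
move=> t01 tE; apply/eqP; rewrite -subr_eq0 -normr_le0.
apply: (@geometric_bound_eq0 _ _ 1) => n.
elim: n t b t01 tE => [|n IH] t b t01 tE.
  have /andP[? ?] := bval_itv b; have /andP[? ?] := t01 0.
  by rewrite expr0 divr1 ler_norml; apply/andP; split; lra.
rewrite (bvalS b) tE.
have := IH (t \o S) (b \o S) (fun k => t01 k.+1) (fun k => tE k.+1).
rewrite exprS invfM; move: (2 ^- n) => r; rewrite !ler_norml /= => /andP[? ?].
by apply/andP; split; lra.
Qed.

(** Greedy digit: 1/2 gets the digit 1, so dyadic points inside the unit interval get their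
    terminating expansion, while 1 is fixed by [sh] and has all digits 1. *)
Definition dg x : bool := 1 / 2 <= x.
Definition sh x : R := 2 * x - (dg x)%:R.
Definition dig x (k : nat) : bool := dg (iter k sh x).

Lemma shE x : x = ((dg x)%:R + sh x) / 2.
Proof. by rewrite /sh; field. Qed.

Lemma sh_itv x : 0 <= x <= 1 -> 0 <= sh x <= 1.
Proof.
by move=> /andP[? ?]; rewrite /sh /dg; case: (leP (1 / 2) x) => ?; apply/andP; split; rewrite /=; lra.
Qed.

Lemma iter_sh_itv k x : 0 <= x <= 1 -> 0 <= iter k sh x <= 1.
Proof. by move=> x01; elim: k => //= k; exact: sh_itv. Qed.

Lemma bval_dig x : 0 <= x <= 1 -> bval (dig x) = x.
Proof.
move=> x01; apply/esym.
apply: (@bval_unfold (fun k => iter k sh x) (dig x)) => k; first exact: iter_sh_itv.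
by rewrite /= -shE.
Qed.

(** The orbit under the shift avoids 1/2, the only point of the unit interval whose leading digit is
    ambiguous. The endpoints 0 and 1 qualify. *)
Definition nondyadic x := forall k, iter k sh x != 1 / 2.

Lemma nondyadic_sh x : nondyadic x -> nondyadic (sh x).
Proof. by move=> nx k; rewrite -iterSr. Qed.

(** The value of [b] lies in the closed half of the unit interval selected by [b 0]. The halves meet
    only at 1/2, which is excluded, so the greedy digit is [b 0]; then shift. *)
Lemma dig_bval b : nondyadic (bval b) -> dig (bval b) = b.
Proof.
move=> nb; apply/funext => k.
elim: k b nb => [|k IH] b nb.
  rewrite /dig /dg /=; have := nb 0 => /=; rewrite (bvalS b).
  have /andP[? ?] := bval_itv (b \o S).
  by case: (b 0) => /= /eqP H; case: leP => //= ?; first lra; case: H; lra.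
have h : dg (bval b) = b 0.
  rewrite /dg; have := nb 0 => /=; rewrite (bvalS b).
  have /andP[? ?] := bval_itv (b \o S).
  by case: (b 0) => /= /eqP H; case: leP => //= ?; first lra; case: H; lra.
have shb : sh (bval b) = bval (b \o S) by rewrite /sh h (bvalS b); field.
rewrite /dig iterSr shb -[b k.+1]/((b \o S) k) -IH// -shb; exact: nondyadic_sh.
Qed.

(** The witness is the open dyadic interval of length [2^-n] with these leading digits. Its positive
    length later gives mass to neighbourhoods. *)
Lemma dig_box n b : exists l r : R, [/\ 0 <= l, l < r, r <= 1 &
  forall x, l < x < r -> forall k, (k < n)%N -> dig x k = b k].
Proof.
elim: n b => [|n IH] b; first by exists 0, 1; split.
have [l [r [l0 lr r1 H]]] := IH (b \o S).
exists (((b 0)%:R + l) / 2), (((b 0)%:R + r) / 2).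
split; try by case: (b 0) => /=; lra.
move=> x /andP[lx xr] k kn.
have h : dg x = b 0.
  by rewrite /dg; case: leP => ?; move: lx xr; case: (b 0) => //= *; lra.
case: k kn => [//|k] kn; rewrite /dig iterSr; apply: (H _ _ k kn).
by rewrite /sh h; apply/andP; split; lra.
Qed.

Definition bxor x y : R := bval (fun k => dig x k (+) dig y k).

Lemma bxor_itv x y : 0 <= bxor x y <= 1.
Proof. exact: bval_itv. Qed.

Lemma bxorC x y : bxor x y = bxor y x.
Proof. by congr bval; apply/funext => k; rewrite addbC. Qed.

Lemma bxorS x y : bxor x y = ((dg x (+) dg y)%:R + bxor (sh x) (sh y)) / 2.
Proof.
rewrite /bxor bvalS; congr ((_ + bval _) / _).
by apply/funext => k /=; rewrite /dig !iterSr.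
Qed.

End Digits.

(** * The Sierpinski tetrahedron through the tent map *)

Section Sierpinski.
Variable R : realType.
Notation T3 := ((R * R) * R)%type.

(* Unless [t] is dyadic, the sign of [iter k tau (1 - 2 * t)] tells whether the
   [k]-th digit of [t] equals the previous one (0 for the first), so
   [0 <= ctri k x] for all [k] says that all digit sums are even. *)
Definition ctri k (x : T3) : R :=
  tri k (1 - 2 * x1 x) (1 - 2 * x2 x) (1 - 2 * x3 x).

(** The tent map strips the three leading digits at the price of three signs, whose product is 1 by
    parity. *)
Lemma tri_digits k (d1 d2 d3 : bool) (t1 t2 t3 : R) : d1 (+) d2 (+) d3 = false ->
  0 <= t1 <= 1 -> 0 <= t2 <= 1 -> 0 <= t3 <= 1 ->
  tri k.+1 (1 - 2 * ((d1%:R + t1) / 2)) (1 - 2 * ((d2%:R + t2) / 2))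
    (1 - 2 * ((d3%:R + t3) / 2)) = tri k (1 - 2 * t1) (1 - 2 * t2) (1 - 2 * t3).
Proof.
move=> d t1P t2P t3P.
rewrite -(tri_sign k (1 - 2 * t1) (1 - 2 * t2) (1 - 2 * t3) d) -!tau_digit//.
by rewrite /tri !iterSr.
Qed.

(** The leading digits fix the signs of the three factors, and parity leaves an even number of
    nonpositive ones. Deeper levels reduce to this one by [tri_digits]. *)
Lemma tri_bval_ge0 k (b1 b2 b3 : nat -> bool) :
  (forall k, b1 k (+) b2 k (+) b3 k = false) ->
  0 <= tri k (1 - 2 * bval R b1) (1 - 2 * bval R b2) (1 - 2 * bval R b3).
Proof.
elim: k b1 b2 b3 => [|k IH] b1 b2 b3 b123.
  rewrite /tri /= (bvalS R b1) (bvalS R b2) (bvalS R b3).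
  have /andP[? ?] := bval_itv R (b1 \o S).
  have /andP[? ?] := bval_itv R (b2 \o S).
  have /andP[? ?] := bval_itv R (b3 \o S).
  move: (b123 0); case: (b1 0) (b2 0) (b3 0) => [] [] []//= _.
  - by rewrite mulr_ge0//; [rewrite mulr_le0//; lra|lra].
  - by rewrite mulr_le0//; [rewrite mulr_le0_ge0//; lra|lra].
  - by rewrite mulr_le0//; [rewrite mulr_ge0_le0//; lra|lra].
  - by rewrite !mulr_ge0//; lra.
rewrite (bvalS R b1) (bvalS R b2) (bvalS R b3) tri_digits ?bval_itv//.
by apply: IH => j; exact: b123.
Qed.

Definition in_cube (x : T3) :=
  [/\ 0 <= x1 x <= 1, 0 <= x2 x <= 1 & 0 <= x3 x <= 1].

(** If the greedy digits have odd sum, the product is also nonpositive, hence zero. Some coordinate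
    is then 1/2, and its free digit is chosen to repair the parity. *)
Lemma even_digits (a b c : R) : 0 <= a <= 1 -> 0 <= b <= 1 -> 0 <= c <= 1 ->
  0 <= (1 - 2 * a) * (1 - 2 * b) * (1 - 2 * c) ->
  exists d1 d2 d3 : bool, d1 (+) d2 (+) d3 = false /\
    [/\ 0 <= 2 * a - d1%:R <= 1, 0 <= 2 * b - d2%:R <= 1 & 0 <= 2 * c - d3%:R <= 1].
Proof.
move=> aP bP cP abc.
(* At 1/2 both digits are legitimate: the remainder is 1 after the digit 0 and 0 after the digit
   1. *)
have half (t : R) (d : bool) : 1 - 2 * t = 0 -> 0 <= 2 * t - d%:R <= 1.
  by move=> tE; case: d; apply/andP; split; rewrite /=; lra.
have [d|d] := boolP (dg a (+) dg b (+) dg c); last first.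
  by exists (dg a), (dg b), (dg c); split; [exact/negbTE|split; exact: sh_itv].
have /eqP : (1 - 2 * a) * (1 - 2 * b) * (1 - 2 * c) = 0.
  apply/le_anti; rewrite abc andbT; move: d; rewrite /dg.
  case: leP => ?; case: leP => ?; case: leP => ?//= _.
  - by rewrite mulr_ge0_le0//; [rewrite mulr_le0//; lra|lra].
  - by rewrite mulr_le0_ge0//; [rewrite mulr_le0_ge0//; lra|lra].
  - by rewrite mulr_le0_ge0//; [rewrite mulr_ge0_le0//; lra|lra].
  - by rewrite mulr_ge0_le0//; [rewrite mulr_ge0//; lra|lra].
rewrite !mulf_eq0 => /orP[/orP[]|] /eqP /half h.
- exists (dg b (+) dg c), (dg b), (dg c); split; first by rewrite -addbA addbb.
  by split; [exact: h|exact: sh_itv..].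
- exists (dg a), (dg a (+) dg c), (dg c); split; first by rewrite addbA addbb addFb addbb.
  by split; [exact: sh_itv|exact: h|exact: sh_itv].
- exists (dg a), (dg b), (dg a (+) dg b); split; first by rewrite addbb.
  by split; [exact: sh_itv..|exact: h].
Qed.

Lemma sierpinski_step (x : T3) : in_cube x -> (forall k, 0 <= ctri k x) ->
  exists d1 d2 d3 : bool, exists x' : T3,
   [/\ d1 (+) d2 (+) d3 = false,
     x1 x = (d1%:R + x1 x') / 2, x2 x = (d2%:R + x2 x') / 2,
     x3 x = (d3%:R + x3 x') / 2 & in_cube x' /\ forall k, 0 <= ctri k x'].
Proof.
case: x => -[a b] c [/= aP bP cP] H.
have [d1 [d2 [d3 [d [h1 h2 h3]]]]] := even_digits aP bP cP (H 0).
exists d1, d2, d3, (2 * a - d1%:R, 2 * b - d2%:R, 2 * c - d3%:R); split => //=.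
- by rewrite /x1/=; field.
- by rewrite /x2/=; field.
- by rewrite /x3/=; field.
split; first by split.
move=> k; rewrite /ctri -(tri_digits k d)//.
have := H k.+1; rewrite /ctri /x1 /x2 /x3 /=.
by congr (0 <= tri _ _ _ _); field.
Qed.

Lemma sierpinskiP (x : T3) :
  @sierpinski_tetrahedron R x <-> in_cube x /\ forall k, 0 <= ctri k x.
Proof.
split=> [[b1 [b2 [b3 []]]]|[]].
  move=> /binary_expansionP e1 /binary_expansionP e2 /binary_expansionP e3 b.
  rewrite /in_cube /ctri e1 e2 e3; split; first by split; exact: bval_itv.
  by move=> k; exact: tri_bval_ge0.
move=> xc xt.
(* Choose for every point a triple of digits and a successor; iterating the successor from [x]
   produces the three expansions. *)
have /choice[f fP] : forall x, exists s : (bool * bool * bool) * T3,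
    in_cube x /\ (forall k, 0 <= ctri k x) ->
   [/\ s.1.1.1 (+) s.1.1.2 (+) s.1.2 = false,
     x1 x = (s.1.1.1%:R + x1 s.2) / 2, x2 x = (s.1.1.2%:R + x2 s.2) / 2,
     x3 x = (s.1.2%:R + x3 s.2) / 2 & in_cube s.2 /\ forall k, 0 <= ctri k s.2].
  move=> {xc xt}x; have [[xc xt]|nx] := pselect (in_cube x /\ forall k, 0 <= ctri k x).
    have [d1 [d2 [d3 [x' [? ? ? ? ?]]]]] := sierpinski_step xc xt.
    by exists ((d1, d2, d3), x').
  (* Arbitrary default outside the invariant, where the implication is vacuous. *)
  by exists ((true, true, true), x).
pose s k := iter k (snd \o f) x.
have sP k : in_cube (s k) /\ forall j, 0 <= ctri j (s k).
  by elim: k => [//|k /fP[]].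
exists (fun k => (f (s k)).1.1.1), (fun k => (f (s k)).1.1.2), (fun k => (f (s k)).1.2).
split; try apply/binary_expansionP.
- apply: (@bval_unfold _ (fun k => x1 (s k))) => k; first by have [[]] := sP k.
  by have [] := fP _ (sP k).
- apply: (@bval_unfold _ (fun k => x2 (s k))) => k; first by have [[]] := sP k.
  by have [] := fP _ (sP k).
- apply: (@bval_unfold _ (fun k => x3 (s k))) => k; first by have [[]] := sP k.
  by have [] := fP _ (sP k).
- by move=> k; have [] := fP _ (sP k).
Qed.

Lemma sierpinski_bxor (x y : R) : 0 <= x <= 1 -> 0 <= y <= 1 ->
  @sierpinski_tetrahedron R (x, y, bxor x y).
Proof.
move=> xP yP; exists (dig x), (dig y), (fun k => dig x k (+) dig y k).
split; rewrite ?binary_expansionP ?bval_dig//.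
by move=> k; rewrite addbb.
Qed.

(** A nondyadic coordinate has a single expansion, and even parity then forces the digits of the
    third one. *)
Lemma sierpinski_graph (x : T3) : @sierpinski_tetrahedron R x ->
  nondyadic (x1 x) -> nondyadic (x2 x) -> x3 x = bxor (x1 x) (x2 x).
Proof.
case=> b1 [b2 [b3 []]].
move=> /binary_expansionP e1 /binary_expansionP e2 /binary_expansionP -> b.
rewrite e1 e2 => n1 n2; rewrite /bxor !dig_bval//; congr bval.
by apply/funext => k; move: (b k); case: (b1 k) (b2 k) (b3 k) => [] [] [].
Qed.

End Sierpinski.

(** * Bitwise addition preserves Lebesgue measure *)

Definition image_measure d d' (T1 : measurableType d) (T2 : measurableType d')
  (R : realFieldType) (m : {measure set T1 -> \bar R}) (f : T1 -> T2)
  (mf : measurable_fun setT f) : {measure set T2 -> \bar R} :=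
  measure_function_pushforward__canonical__measure_function_Measure m mf.

Section XorMeasure.
Variable R : realType.
Notation mu := (@lebesgue_measure R).
Implicit Types (x y t : R).

Lemma measurable_dg : measurable_fun [set: R] (fun x => (dg x)%:R : R).
Proof.
rewrite (_ : (fun x => _) = \1_(`[1 / 2, +oo[%classic : set R)).
  by apply: measurable_indic; exact: measurable_itv.
apply/funext => x; rewrite indicE; congr (nat_of_bool _)%:R.
by apply/idP/idP; rewrite inE /= in_itv /= andbT.
Qed.

Lemma measurable_sh : measurable_fun [set: R] (@sh R).
Proof.
by apply: measurable_funB; [exact: measurable_funM|exact: measurable_dg].
Qed.

Lemma measurable_iter_sh k : measurable_fun [set: R] (iter k (@sh R)).
Proof.
by elim: k => [|k IH]; [exact: measurable_id|exact: measurableT_comp measurable_sh IH].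
Qed.

Lemma measurable_dig k : measurable_fun [set: R] (fun x => (dig x k)%:R : R).
Proof. exact: measurableT_comp measurable_dg (measurable_iter_sh k). Qed.

Lemma measurable_bxor : measurable_fun [set: R * R] (fun z : R * R => bxor z.1 z.2).
Proof.
apply: (@measurable_fun_cvg _ _ _ _
  (fun n (z : R * R) => bsum R (fun k => dig z.1 k (+) dig z.2 k) n)).
  move=> n; rewrite /bsum.
  apply: measurable_sum => k; apply: measurable_funM => //.
  (* On 0/1 values, exclusive or is the polynomial [u + v - 2uv]. *)
  rewrite (_ : (fun z : R * R => _) =
    (fun z : R * R => (dig z.1 k)%:R + (dig z.2 k)%:R
      - 2 * ((dig z.1 k)%:R * (dig z.2 k)%:R) : R)); last first.
    by apply/funext => z; case: (dig z.1 k) (dig z.2 k) => [] []/=; ring.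
  have m1 : measurable_fun setT (fun z : R * R => (dig z.1 k)%:R : R).
    exact: measurableT_comp (measurable_dig k) measurable_fst.
  have m2 : measurable_fun setT (fun z : R * R => (dig z.2 k)%:R : R).
    exact: measurableT_comp (measurable_dig k) measurable_snd.
  apply: measurable_funB; first exact: measurable_funD.
  by apply: measurable_funM => //; exact: measurable_funM.
by move=> z _; exact: bsum_cvg.
Qed.

Lemma measurable_bxor_right x : measurable_fun [set: R] (bxor x).
Proof.
exact: (measurable_fun_pair2 x measurable_bxor).
Qed.

(** Twice the image of Lebesgue measure under [y |-> 2y - c] agrees with Lebesgue measure on
    half-open intervals, which determine it. *)
Lemma lebesgue_measure_affine (c : R) (A : set R) : measurable A ->
  mu A = (2%:E * mu [set y | A (2 * y - c)%R])%E.
Proof.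
move=> mA; pose f y : R := 2 * y - c.
have mf : measurable_fun setT f by apply: measurable_funB => //; exact: measurable_funM.
pose nu : {measure set (measurableTypeR R) -> \bar R} := mscale (NngNum (ler0n R 2)) 
  (@image_measure _ _ (measurableTypeR R) (measurableTypeR R) _ mu f mf).
apply: (@lebesgue_measure_unique R nu) => // {A mA}.
move=> _ [[a b] _ <-] /=.
rewrite -[RHS]/(2%:E * mu (f @^-1` `]a, b]%classic))%E.
rewrite (_ : f @^-1` _ = `](a + c) / 2, (b + c) / 2]%classic); last first.
  apply/seteqP; split => y; rewrite /f /= !in_itv /= => /andP[? ?];
  by apply/andP; split; lra.
rewrite !lebesgue_measure_itv /= !lte_fin.
have -> : ((a + c) / 2 < (b + c) / 2) = (a < b) by apply/idP/idP => ?; lra.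
by case: ifPn => _; rewrite ?mule0// -!EFinB -EFinM; congr EFin; field.
Qed.

Lemma lebesgue_measure_halfopen (B : set R) : measurable B ->
  mu (`[0, 1]%classic `&` B) = mu (`[0, 1[%classic `&` B).
Proof.
move=> mB.
have m1 : measurable (`[0, 1[%classic `&` B : set R) by apply: measurableI.
have m2 : measurable ([set 1] `&` B : set R) by apply: measurableI.
have -> : `[0, 1]%classic `&` B = (`[0, 1[%classic `&` B) `|` ([set 1] `&` B).
  rewrite -setIUl; congr (_ `&` _); rewrite setUitv1// bnd_simp; lra.
rewrite measureU//; last first.
  by rewrite -subset0 => y /=; rewrite in_itv /= => -[[/andP[_ y1] _] [yE _]]; rewrite yE ltxx in y1.
rewrite [X in (_ + X)%E](_ : _ = 0%E) ?adde0//.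
apply/eqP; rewrite eq_le; apply/andP; split => //.
rewrite -[leRHS](@lebesgue_measure_set1 R 1).
by apply: le_measure; rewrite ?inE.
Qed.

(** * The law of [y |-> x xor y] through its distribution function *)

Definition bxor_cdf x t : R := fine (mu (`[0, 1]%classic `&` [set y | bxor x y <= t])).

Lemma measurable_bxor_le x t : measurable [set y | bxor x y <= t].
Proof.
rewrite -[X in measurable X]setTI.
have := measurable_bxor_right x => /(_ measurableT `]-oo, t]%classic (measurable_itv _)).
by congr measurable; apply/seteqP; split => y /=; rewrite in_itv.
Qed.

Lemma bxor_cdfE x t : mu (`[0, 1]%classic `&` [set y | bxor x y <= t]) = (bxor_cdf x t)%:E.
Proof.
rewrite /bxor_cdf fineK// ge0_fin_numE// (@le_lt_trans _ _ (mu `[0, 1]%classic))//.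
  apply: le_measure => //; rewrite ?inE//; apply: measurableI => //.
  exact: measurable_bxor_le.
by rewrite lebesgue_measure_itv /= lte_fin ltr01 -EFinB ltry.
Qed.

Lemma bxor_cdf_itv x t : 0 <= bxor_cdf x t <= 1.
Proof.
rewrite -!lee_fin -bxor_cdfE measure_ge0 /=.
have <- : mu `[0, 1]%classic = 1%:E.
  by rewrite lebesgue_measure_itv /= lte_fin ltr01 -EFinB subr0.
apply: le_measure => //; rewrite ?inE//; apply: measurableI => //.
exact: measurable_bxor_le.
Qed.

(** Split by the first digit of [y] and rescale each half. The first digit of the sum is 0 on one
    half and 1 on the other, giving the thresholds [2t] and [2t - 1]; which half is which depends on
    [x], but the average does not. *)
Lemma bxor_cdfS x t : bxor_cdf x t = (bxor_cdf (sh x) (2 * t) + bxor_cdf (sh x) (2 * t - 1)) / 2.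
Proof.
have disj (u : R) : 2 * u - 0 < 1 -> 0 <= 2 * u - 1 -> False by lra.
pose B s := `[0, 1]%classic `&` [set y | bxor (sh x) y <= s].
pose B' s := `[0, 1[%classic `&` [set y | bxor (sh x) y <= s].
have mB s : measurable (B s) by apply: measurableI => //; exact: measurable_bxor_le.
have mB' s : measurable (B' s) by apply: measurableI => //; exact: measurable_bxor_le.
pose d : R := (dg x)%:R.
(* The left half is half-open to make the pieces disjoint, and [- 0] keeps both in the shape of
   [lebesgue_measure_affine]. *)
have split_ : `[0, 1]%classic `&` [set y | bxor x y <= t] =
    [set y | B' (2 * t - d) (2 * y - 0)] `|` [set y | B (2 * t - (1 - d)) (2 * y - 1)].
  apply/seteqP; split => y /=; rewrite /B /B' /= !in_itv /= (bxorS x y) /d.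
    have [y2|y2] := leP (1 / 2) y => -[/andP[? ?] h]; [right|left].
      have yd : dg y = true by [].
      have shy : sh y = 2 * y - 1 by rewrite /sh yd.
      split; first by apply/andP; split; lra.
      by move: h; rewrite shy yd; case: (dg x) => /=; lra.
    have yd : dg y = false by apply/negbTE; rewrite -ltNge.
    have shy : sh y = 2 * y - 0 by rewrite /sh yd.
    split; first by apply/andP; split; lra.
    by move: h; rewrite shy yd; case: (dg x) => /=; lra.
  move=> [] [/andP[? ?] h]; split; try (by apply/andP; split; lra).
    have yd : dg y = false by apply/negbTE; rewrite -ltNge; lra.
    have shy : sh y = 2 * y - 0 by rewrite /sh yd.
    by move: h; rewrite shy yd; case: (dg x) => /=; lra.
  have yd : dg y = true by rewrite /dg; lra.
  have shy : sh y = 2 * y - 1 by rewrite /sh yd.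
  by move: h; rewrite shy yd; case: (dg x) => /=; lra.
have mf (c : R) : measurable_fun [set: R] (fun y => 2 * y - c).
  by apply: measurable_funB => //; exact: measurable_funM.
have mp (c : R) (A : set R) : measurable A -> measurable [set y | A (2 * y - c)].
  by move=> mA; rewrite -[X in measurable X]setTI; exact: mf.
have h1 : (2%:E * mu [set y | B' (2 * t - d)%R (2 * y - 0)%R] = (bxor_cdf (sh x) (2 * t - d))%:E)%E.
  by rewrite -lebesgue_measure_affine// -bxor_cdfE lebesgue_measure_halfopen//; exact: measurable_bxor_le.
have h2 : (2%:E * mu [set y | B (2 * t - (1 - d))%R (2 * y - 1)%R] =
    (bxor_cdf (sh x) (2 * t - (1 - d)))%:E)%E.
  by rewrite -lebesgue_measure_affine// -bxor_cdfE.
have : (2%:E * (bxor_cdf x t)%:E = (bxor_cdf (sh x) (2 * t - d) + bxor_cdf (sh x) (2 * t - (1 - d)))%:E)%E.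
  rewrite -bxor_cdfE split_ measureU//; [|exact: mp|exact: mp|].
    by rewrite muleDr ?ge0_adde_def ?inE ?measure_ge0// h1 h2.
  rewrite -subset0 => y /=; rewrite /B /B' /= !in_itv /=.
  by move=> [[/andP[_ u1] _] [/andP[u2 _] _]]; exact: disj u1 u2.
rewrite -EFinM => -[] {h1 h2 split_ mB mB' mf mp B B'}.
by rewrite /d; case: (dg x) => /=; rewrite ?subrr !subr0; lra.
Qed.

(** The distribution function of the uniform law on the unit interval; it serves later as the
    retraction onto that interval. *)
Definition clamp t : R := Num.max 0 (Num.min t 1).

Lemma clamp_itv t : 0 <= clamp t <= 1.
Proof. by rewrite /clamp le_max lexx ge_max ler01 ge_min lexx orbT. Qed.

Lemma clampP t : clamp t = if t <= 0 then 0 else if 1 <= t then 1 else t.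
Proof.
rewrite /clamp; have [t0|t0] := leP t 0.
  by rewrite (min_idPl _) ?(max_idPl _)//; lra.
by have [t1|t1] := leP 1 t; rewrite (max_idPr _)//; lra.
Qed.

(** The same two-scale equation as for [bxor_cdf]. *)
Lemma clampS t : clamp t = (clamp (2 * t) + clamp (2 * t - 1)) / 2.
Proof.
rewrite !clampP; have [t0|t0] := leP t 0; have [t1|t1] := leP 1 t.
- lra.
- by rewrite !ifT; lra.
- rewrite [2 * t <= 0]lt_geF; last lra.
  rewrite [2 * t - 1 <= 0]lt_geF; last lra.
  by rewrite !ifT; lra.
- rewrite [2 * t <= 0]lt_geF; last lra.
  rewrite [1 <= 2 * t - 1]lt_geF; last lra.
  by have [?|?] := leP (2 * t - 1) 0; have [?|?] := leP 1 (2 * t); lra.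
Qed.

Lemma bxor_cdf_lt0 x t : t < 0 -> bxor_cdf x t = 0.
Proof.
move=> t0; apply: EFin_inj; rewrite -bxor_cdfE (_ : _ `&` _ = set0) ?measure0//.
rewrite -subset0 => y /= [_ yt].
by have /andP[y0 _] := bxor_itv x y; have := le_lt_trans (le_trans y0 yt) t0; rewrite ltxx.
Qed.

Lemma bxor_cdf_ge1 x t : 1 <= t -> bxor_cdf x t = 1.
Proof.
move=> t1; apply: EFin_inj; rewrite -bxor_cdfE (_ : _ `&` _ = `[0, 1]%classic).
  by rewrite lebesgue_measure_itv /= lte_fin ltr01 -EFinB subr0.
apply/setIidPl => y _ /=.
by have /andP[_ y1] := bxor_itv x y; exact: le_trans t1.
Qed.

(** Both sides solve one two-scale equation and agree for [t < 0] and for [1 <= t], so each use of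
    the equation halves the bound on their distance. *)
Lemma bxor_cdf_clamp x t : bxor_cdf x t = clamp t.
Proof.
apply/eqP; rewrite -subr_eq0 -normr_le0.
apply: (@geometric_bound_eq0 _ _ 1) => n.
elim: n x t => [|n IH] x t.
  have /andP[? ?] := bxor_cdf_itv x t; have /andP[? ?] := clamp_itv t.
  by rewrite expr0 divr1 ler_norml; apply/andP; split; lra.
rewrite bxor_cdfS clampS; have IH1 := IH (sh x) (2 * t); have IH2 := IH (sh x) (2 * t - 1).
have e0 u : u < 0 -> bxor_cdf (sh x) u = clamp u.
  by move=> u0; rewrite bxor_cdf_lt0// clampP ltW.
have e1 u : 1 <= u -> bxor_cdf (sh x) u = clamp u.
  by move=> u1; rewrite bxor_cdf_ge1// clampP ifF ?u1//; apply/negbTE; rewrite -ltNge; lra.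
(* The averaging contracts because only one of the two values is not trivial. *)
have : bxor_cdf (sh x) (2 * t) = clamp (2 * t) \/
    bxor_cdf (sh x) (2 * t - 1) = clamp (2 * t - 1).
  by case: (ltP t (1 / 2)) => ?; [right; apply: e0|left; apply: e1]; lra.
move: IH1 IH2; rewrite exprS invfM; move: (2 ^- n) => r {IH}.
move: (bxor_cdf _ (2 * t)) (bxor_cdf _ (2 * t - 1)) (clamp (2 * t)) (clamp (2 * t - 1)) => p q u v.
rewrite !ler_norml => /andP[? ?] /andP[? ?] [?|?];
by apply/andP; split; lra.
Qed.

Lemma measure_of_cdf (g : R -> R) (a b : R) : measurable_fun setT g -> a <= b ->
  (forall t, mu (`[0, 1]%classic `&` [set y | g y <= t]) = (clamp t)%:E) ->
  mu (`[0, 1]%classic `&` [set y | a < g y <= b]) = (clamp b - clamp a)%:E.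
Proof.
move=> mg ab H.
have mitv (i : interval R) : measurable [set y | g y \in i].
  rewrite -[X in measurable X]setTI.
  exact: (mg measurableT [set` i] (measurable_itv i)).
have m1 : measurable (`[0, 1]%classic `&` [set y | g y <= a]).
  by apply: measurableI => //; have := mitv `]-oo, a];
   congr measurable; apply/seteqP; split => y /=; rewrite in_itv.
have m2 : measurable (`[0, 1]%classic `&` [set y | a < g y <= b]).
  by apply: measurableI => //; have := mitv `]a, b];
   congr measurable; apply/seteqP; split => y /=; rewrite in_itv.
have := H b.
have -> : `[0, 1]%classic `&` [set y | g y <= b] =
   (`[0, 1]%classic `&` [set y | g y <= a]) `|` (`[0, 1]%classic `&` [set y | a < g y <= b]).
  rewrite -setIUr; congr (_ `&` _); apply/seteqP; split => y /=.
    by case: (leP (g y) a) => ? ?; [left|right].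
  by case=> [|/andP[_ //]] /le_trans; apply.
rewrite measureU//; last first.
  rewrite -subset0 => y /= [[_ h1] [_ /andP[h2 _]]].
  by move: (lt_le_trans h2 h1); rewrite ltxx.
rewrite [X in (X + _)%E]H.
(* The unknown measure is finite, since adding a finite number to it gives a finite number; hence
   the subtraction is legitimate. *)
set z := (X in (_ + X)%E); rewrite -[mu _]/z.
by case: z => [r [rE]|//|//]; congr EFin; apply/eqP; rewrite eq_sym subr_eq addrC -rE.
Qed.

Lemma id_cdf t : mu (`[0, 1]%classic `&` [set y | y <= t]) = (clamp t)%:E.
Proof.
rewrite (_ : _ `&` _ = `[0, Num.min t 1]%classic); last first.
  apply/seteqP; split => y /=; rewrite !in_itv /= le_min.
    by move=> [/andP[-> ->] ->].
  by move=> /and3P[-> -> ->].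
rewrite lebesgue_measure_itv /= lte_fin /clamp.
by case: (ltP 0 (Num.min t 1)) => ?; rewrite ?subr0 ?sub0r ?oppr0 ?adde0// -?EFinB ?subr0.
Qed.

(** Uniqueness of Lebesgue measure concerns the whole line, so the image of its restriction to the
    unit interval is completed by Lebesgue measure outside; the sum agrees with [mu] on half-open
    intervals. *)
Lemma lebesgue_measure_bxor x (B : set R) : measurable B ->
  mu (`[0, 1]%classic `&` [set y | B (bxor x y)]) = mu (`[0, 1]%classic `&` B).
Proof.
move=> mB.
have m01 : measurable (`[0, 1]%classic : set (measurableTypeR R)) by exact: measurable_itv.
have mC01 : measurable (~` `[0, 1]%classic : set (measurableTypeR R)) by exact: measurableC.
pose nu1 : {measure set (measurableTypeR R) -> \bar R} := mrestr mu m01.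
pose nu2 : {measure set (measurableTypeR R) -> \bar R} := mrestr mu mC01.
pose nu3 : {measure set (measurableTypeR R) -> \bar R} :=
  @image_measure _ _ (measurableTypeR R) (measurableTypeR R) _ nu1 _ (measurable_bxor_right x).
pose nu : {measure set (measurableTypeR R) -> \bar R} := measure_add nu3 nu2.
have nuE (A : set R) : nu A =
    (mu (`[0%R, 1%R] `&` [set y | A (bxor x y)])%classic + mu (A `&` ~` `[0%R, 1%R])%classic)%E.
  have -> : nu A = (nu3 A + nu2 A)%E := measure_addE nu3 nu2 A.
  by rewrite -[nu3 A]/(mu ([set y | A (bxor x y)] `&` `[0%R, 1%R])%classic) setIC.
have H : forall A, measurable A -> mu A = nu A.
  apply: lebesgue_measure_unique => _ [[a b] _ <-] /=; rewrite nuE.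
  have [ab|ba] := leP a b; last first.
    have -> : `]a, b]%classic = set0 :> set R by rewrite set_itv_ge// bnd_simp -leNgt ltW.
    rewrite set0I [X in (mu X + _)%E](_ : _ = set0) ?measure0 ?adde0//.
    by apply/seteqP; split=> y // [].
  have mab : measurable (`]a, b]%classic : set R) by exact: measurable_itv.
  have -> : mu `]a, b]%classic = (mu (`[0%R, 1%R] `&` [set y | (a < y <= b)%R])%classic +
      mu (`]a, b] `&` ~` `[0%R, 1%R])%classic)%E.
    rewrite -[in LHS](setIT `]a, b]%classic) -(setUv `[0, 1]%classic) setIUr measureU//.
    - by rewrite setIC.
    - exact: measurableI.
    - exact: measurableI.
    - by rewrite setIACA setICr setI0.
  congr (_ + _)%E; rewrite (@measure_of_cdf idfun a b _ ab id_cdf); last exact: measurable_id.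
  rewrite -(measure_of_cdf (measurable_bxor_right x) ab); last first.
    by move=> t; rewrite bxor_cdfE bxor_cdf_clamp.
  by congr (mu (_ `&` _)); apply/seteqP; split => y /=; rewrite in_itv.
have := H (`[0, 1]%classic `&` B); rewrite nuE => ->; last by apply: measurableI.
rewrite [X in (_ + X)%E](_ : _ = 0%E) ?adde0; last first.
  by rewrite setIAC setICr set0I measure0.
congr (mu _); apply/seteqP; split => y /= [y01]; last by case.
by move=> ?; split => //; split => //; rewrite in_itv; exact: bxor_itv.
Qed.

End XorMeasure.

(** * The measure carried by the graph of the bitwise sum, and its marginals *)

Section Plane.
Variable R : realType.
Notation T3 := ((R * R) * R)%type.
Notation mu := (@lebesgue_measure R).
Notation mu2 := (mu \x mu)%E.

Lemma measurable_unit_square : measurable (@unit_square R).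
Proof. by apply: measurableX; exact: measurable_itv. Qed.

Lemma leb_square_setT : leb_square [set: R * R] = 1%E.
Proof.
transitivity (mu `[0%R, 1%R]%classic * mu `[0%R, 1%R]%classic)%E.
  by rewrite /leb_square setTI; apply: product_measure1E; exact: measurable_itv.
by rewrite lebesgue_measure_itv /= lte_fin ltr01 -EFinB subr0 mule1.
Qed.

Lemma leb_square_swap (A : set (R * R)) : measurable A ->
  leb_square [set z | A (z.2, z.1)] = leb_square A.
Proof.
move=> mA.
have msw : measurable_fun setT (fun z : R * R => (z.2, z.1)).
  by apply: measurable_fun_pair; [exact: measurable_snd|exact: measurable_fst].
pose nu : {measure set (measurableTypeR R * measurableTypeR R) -> \bar R} :=
  @image_measure _ _ (measurableTypeR R * measurableTypeR R)%type
   (measurableTypeR R * measurableTypeR R)%type _ mu2 _ msw.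
have H : forall X : set (R * R), measurable X -> mu2 X = nu X.
  apply: (@product_measure_unique _ _ _ _ _ mu mu nu) => A' B' mA' mB'.
  rewrite -[LHS]/(mu2 [set z | (A' `*` B') (z.2, z.1)]).
  rewrite (_ : [set z | _] = B' `*` A'); last first.
    by apply/seteqP; split => -[y z] [].
  by rewrite product_measure1E// muleC.
rewrite /leb_square [RHS]H; last exact: measurableI _ _ mA measurable_unit_square.
rewrite -[RHS]/(mu2 [set z | (A `&` @unit_square R) (z.2, z.1)]).
congr (mu2 _); apply/seteqP; split => -[y z] /= [? [? ?]]; by split.
Qed.

(** Compare vertical sections: for fixed [x] in the unit interval, [bxor x] preserves the measure;
    for other [x] both sections are empty. *)
Lemma leb_square_bxor (A : set (R * R)) : measurable A ->
  leb_square [set z | A (z.1, bxor z.1 z.2)] = leb_square A.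
Proof.
move=> mA; rewrite /leb_square /= /product_measure1.
apply: eq_integral => x _ /=.
have [x01|x01] := pselect (x \in `[0, 1]%R).
  transitivity (mu (`[0, 1]%classic `&` [set y | xsection A x (bxor x y)])).
    congr (mu _); apply/seteqP; split => y; rewrite /xsection /unit_square /= !inE /=.
      by move=> [? [? ?]].
    by move=> [? ?].
  rewrite lebesgue_measure_bxor; last exact: measurable_xsection.
  congr (mu _); apply/seteqP; split => y; rewrite /xsection /unit_square /= !inE /=.
    by move=> [? ?].
  by move=> [? [? ?]].
congr (mu _); apply/seteqP; split => y; rewrite /xsection /unit_square /= !inE /=.
  by move=> [_ [/x01]].
by move=> [_ [/x01]].
Qed.

Lemma leb_square_box (A B : set R) : measurable A -> measurable B ->
  A `<=` `[0, 1]%classic -> B `<=` `[0, 1]%classic ->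
  leb_square (A `*` B) = (mu A * mu B)%E.
Proof.
move=> mA mB A1 B1; rewrite /leb_square (_ : _ `&` _ = A `*` B).
  by rewrite product_measure1E.
by apply/setIidPl => -[x y] [/A1 ? /B1 ?].
Qed.

Definition bxor_graph (z : R * R) : T3 := (z.1, z.2, bxor z.1 z.2).

Lemma measurable_bxor_graph : measurable_fun setT bxor_graph.
Proof.
apply: measurable_fun_pair; last exact: measurable_bxor.
by apply: measurable_fun_pair.
Qed.

Definition bxor_law : set T3 -> \bar R :=
  pushforward (mrestr mu2 measurable_unit_square) bxor_graph.

HB.instance Definition _ := Measure.copy bxor_law
  (@image_measure _ _ (measurableTypeR R * measurableTypeR R)%type T3 _
    (mrestr mu2 measurable_unit_square) _ measurable_bxor_graph).

Lemma bxor_law_setT : bxor_law setT = 1%E.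
Proof. by rewrite /bxor_law /pushforward preimage_setT; exact: leb_square_setT. Qed.

HB.instance Definition _ := Measure_isProbability.Build _ _ _ bxor_law bxor_law_setT.

Definition bxor_prob : probability T3 R := bxor_law.

Lemma bxor_probE (A : set T3) : bxor_prob A = leb_square (bxor_graph @^-1` A).
Proof. by []. Qed.

Lemma bxor_prob_ae (A : set T3) :
  (forall x y : R, 0 <= x <= 1 -> 0 <= y <= 1 -> A (x, y, bxor x y)) ->
  bxor_prob A = 1%E.
Proof.
move=> H; rewrite bxor_probE -leb_square_setT /leb_square; congr (mu2 _).
rewrite setTI; apply/setIidPr => -[x y] [/=]; rewrite !in_itv /=.
exact: H.
Qed.

(** The first marginal is immediate, the second is [leb_square_bxor], and the third follows from the
    second by exchanging the coordinates, as [bxor] is symmetric. *)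
Lemma admissible_bxor_prob : admissible bxor_prob.
Proof.
split.
  apply: bxor_prob_ae => x y x01 y01; rewrite /unit_cube /unit_square /= !in_itv /=.
  by split; [split|exact: bxor_itv].
move=> A mA; rewrite !bxor_probE; split.
- by congr leb_square; apply/seteqP; split => -[x y].
- by rewrite -[RHS]leb_square_bxor.
- have mB : measurable [set z : R * R | A (z.1, bxor z.1 z.2)].
    rewrite -[X in measurable X]setTI.
    exact: (measurable_fun_pair measurable_fst (@measurable_bxor R)).
  transitivity (leb_square [set z : R * R | A (z.1, bxor z.1 z.2)]).
    rewrite -(leb_square_swap mB); congr leb_square.
    by apply/seteqP; split => -[x y]; rewrite /Pr23/= /x2 /x3 /= bxorC.
  exact: leb_square_bxor.
Qed.

End Plane.

(** * Decomposition of the cost *)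

Section Optimality.
Variable R : realType.
Notation T3 := ((R * R) * R)%type.
Notation mu := (@lebesgue_measure R).
Implicit Types (pi : probability T3 R).

(** The bound propagates since [1 / 3 + 1 + 1 + 1 <= 8]. *)
Lemma dual_le1 n (a b : R) : -1 <= a <= 1 -> -1 <= b <= 1 -> `|dual n a b| <= 1.
Proof.
elim: n a b => [|n IH] a b a1 b1 /=; first by rewrite ler_norml; apply/andP; split; lra.
have := IH _ _ (tau_itv a1) (tau_itv b1); move: (dual n _ _) => d.
have := tau_itv a1; have := tau_itv b1; move: (tau a) (tau b) => u v u1 v1.
have : `|u * v| <= 1 by rewrite normrM mulr_ile1// ler_norml.
move: u1 v1; rewrite !ler_norml => /andP[? ?] /andP[? ?] /andP[? ?] /andP[? ?].
by apply/andP; split; lra.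
Qed.

Lemma measurable_tau : measurable_fun setT (@tau R).
Proof. by apply: measurable_funB => //; apply: measurable_funM => //; exact: measurable_normr. Qed.

Lemma measurable_dual n d (T : measurableType d) (f g : T -> R) :
  measurable_fun setT f -> measurable_fun setT g ->
  measurable_fun setT (fun x => dual n (f x) (g x)).
Proof.
elim: n f g => [|n IH] f g mf mg /=; first exact: measurable_cst.
have mtf : measurable_fun setT (fun x => tau (f x)) := measurableT_comp measurable_tau mf.
have mtg : measurable_fun setT (fun x => tau (g x)) := measurableT_comp measurable_tau mg.
apply: measurable_funM; last exact: measurable_cst.
apply: measurable_funD; last exact: IH.
apply: measurable_funB; last exact: measurable_funM.
apply: measurable_funB; first exact: measurable_cst.
by apply: measurable_funM; [exact: measurable_funD|exact: measurable_cst].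
Qed.

Lemma measurable_gap n d (T : measurableType d) (f g h : T -> R) :
  measurable_fun setT f -> measurable_fun setT g -> measurable_fun setT h ->
  measurable_fun setT (fun x => gap n (f x) (g x) (h x)).
Proof.
elim: n f g h => [|n IH] f g h mf mg mh /=.
  apply: measurable_funB; first exact: measurable_cst.
  by apply: measurable_funM => //; exact: measurable_funM.
have mfgh : measurable_fun setT (fun x => f x * g x * h x).
  by apply: measurable_funM => //; exact: measurable_funM.
apply: measurable_funD.
  by apply: measurable_funB => //; exact: measurableT_comp.
apply: measurable_funM; last exact: measurable_cst.
by apply: IH; exact: measurableT_comp measurable_tau _.
Qed.

Lemma measurable_tri k d (T : measurableType d) (f g h : T -> R) :
  measurable_fun setT f -> measurable_fun setT g -> measurable_fun setT h ->
  measurable_fun setT (fun x => tri k (f x) (g x) (h x)).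
Proof.
rewrite /tri; elim: k f g h => [|k IH] f g h mf mg mh /=.
  by apply: measurable_funM => //; exact: measurable_funM.
rewrite (_ : (fun x => _) = (fun x => iter k (@tau R) (tau (f x)) *
  iter k (@tau R) (tau (g x)) * iter k (@tau R) (tau (h x)))).
  by apply: IH; exact: measurableT_comp measurable_tau _.
by apply/funext => x; rewrite -!iterSr.
Qed.

Lemma measurable_x1 : measurable_fun setT (@x1 R).
Proof. exact: measurableT_comp measurable_fst measurable_fst. Qed.

Lemma measurable_x2 : measurable_fun setT (@x2 R).
Proof. exact: measurableT_comp measurable_snd measurable_fst. Qed.

Lemma measurable_x3 : measurable_fun setT (@x3 R).
Proof. exact: measurable_snd. Qed.

Lemma measurable_clamp : measurable_fun setT (@clamp R).
Proof. by apply: measurable_maxr => //; exact: measurable_minr. Qed.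

Lemma clamp_id (t : R) : 0 <= t <= 1 -> clamp t = t.
Proof.
by move=> /andP[t0 t1]; rewrite clampP; case: ifPn => ?; [lra|case: ifPn => ?; lra].
Qed.

(* Clamping makes all the functions below bounded on the whole space and does
   not change them on the cube. *)
Definition centered (t : R) : R := 1 - 2 * clamp t.

Lemma centered_itv t : -1 <= centered t <= 1.
Proof. by have /andP[? ?] := clamp_itv t; rewrite /centered; apply/andP; split; lra. Qed.

Lemma measurable_centered : measurable_fun setT centered.
Proof.
apply: measurable_funB => //; apply: measurable_funM => //; exact: measurable_clamp.
Qed.

(** With [a_i = 1 - 2 x_i], [8 x_1 x_2 x_3] is [1 - 2 \sum x_i + 4 \sum x_i x_j - a_1 a_2 a_3]. This
    is the share of one pair, with [dual] accounting for its part of the last term. *)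
Definition pairf n (z : R * R) : R :=
  (1 / 3 - (clamp z.1 + clamp z.2) + 4 * (clamp z.1 * clamp z.2)
   + dual n (centered z.1) (centered z.2)) / 8.

Definition gapf n (x : T3) : R := gap n (centered (x1 x)) (centered (x2 x)) (centered (x3 x)).

Definition trif k (x : T3) : R := tri k (centered (x1 x)) (centered (x2 x)) (centered (x3 x)).

Lemma measurable_gapf n : measurable_fun setT (gapf n).
Proof.
apply: measurable_gap; apply: (measurableT_comp measurable_centered).
- exact: measurable_x1.
- exact: measurable_x2.
- exact: measurable_x3.
Qed.

Lemma measurable_trif k : measurable_fun setT (trif k).
Proof.
apply: measurable_tri; apply: (measurableT_comp measurable_centered).
- exact: measurable_x1.
- exact: measurable_x2.
- exact: measurable_x3.
Qed.

Lemma measurable_pairf n : measurable_fun setT (pairf n).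
Proof.
have m1 : measurable_fun setT (fun z : R * R => clamp z.1).
  exact: measurableT_comp measurable_clamp measurable_fst.
have m2 : measurable_fun setT (fun z : R * R => clamp z.2).
  exact: measurableT_comp measurable_clamp measurable_snd.
apply: measurable_funM; last exact: measurable_cst.
apply: measurable_funD; last first.
  apply: measurable_dual.
    exact: measurableT_comp measurable_centered measurable_fst.
  exact: measurableT_comp measurable_centered measurable_snd.
apply: measurable_funD; last by apply: measurable_funM => //; exact: measurable_funM.
apply: measurable_funB; first exact: measurable_cst.
exact: measurable_funD.
Qed.

Lemma pairf_le1 n z : `|pairf n z| <= 1.
Proof.
have := dual_le1 n (centered_itv z.1) (centered_itv z.2).
rewrite /pairf; move: (dual _ _ _) => d.
have := clamp_itv z.1; have := clamp_itv z.2; move: (clamp _) (clamp _) => u v.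
move=> /andP[u0 u1] /andP[v0 v1].
have : 0 <= v * u by exact: mulr_ge0.
have : v * u <= 1 by exact: mulr_ile1.
rewrite !ler_norml => ? ? /andP[? ?]; apply/andP; split; lra.
Qed.

Lemma cost_decomposition n (x : T3) : in_cube x ->
  cost x = pairf n (Pr12 x) + pairf n (Pr13 x) + pairf n (Pr23 x) + gapf n x / 8.
Proof.
move=> [/clamp_id h1 /clamp_id h2 /clamp_id h3].
have := dual_gap n (centered (x1 x)) (centered (x2 x)) (centered (x3 x)).
rewrite /cost /pairf /gapf /= /centered h1 h2 h3.
move: (gap _ _ _ _) (dual _ _ _) (dual _ _ _) (dual _ _ _) => p q r s e.
have -> : p = - ((1 - 2 * x1 x) * (1 - 2 * x2 x) * (1 - 2 * x3 x)) - q - r - s by lra.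
by field.
Qed.

End Optimality.

(** * Minimizers are carried by the tetrahedron *)

Section Minimizers.
Variable R : realType.
Notation T3 := ((R * R) * R)%type.
Notation mu := (@lebesgue_measure R).
Implicit Types (pi : probability T3 R).

Lemma bounded_integrable d (T : measurableType d) (P : {finite_measure set T -> \bar R})
  (f : T -> R) (M : R) : measurable_fun setT f -> (forall x, `|f x| <= M) ->
  P.-integrable setT (EFin \o f).
Proof.
move=> mf fM; apply: measurable_bounded_integrable => //; first exact: fin_num_fun_lty.
by exists M; split=> [|r Mr x _]; [exact: num_real|exact: le_trans (ltW Mr)].
Qed.

Lemma ae_le_measure d (T : measurableType d) (P : {measure set T -> \bar R}) (A B : set T) :
  measurable A -> measurable B -> {ae P, forall x, A x -> B x} -> (P A <= P B)%E.
Proof.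
move=> mA mB [N [mN N0 AB]].
apply: (@le_trans _ _ (P (B `|` N))).
  apply: le_measure; rewrite ?inE//; first exact: measurableU.
  move=> x Ax; have [Bx|nBx] := pselect (B x); [by left|right].
  by apply: AB => /= /(_ Ax).
apply: (le_trans (measureU2 _ mB mN)).
by rewrite [X in (_ + X)%E]N0 adde0.
Qed.

Lemma probability1_ae d (T : measurableType d) (P : probability T R) (A : set T) :
  measurable A -> P A = 1%E -> {ae P, forall x, A x}.
Proof.
move=> mA PA; exists (~` A); split => //; first exact: measurableC.
by rewrite probability_setC// PA subee.
Qed.

Lemma measurable_unit_cube : measurable (@unit_cube R).
Proof. by apply: measurableX; [exact: measurable_unit_square|exact: measurable_itv]. Qed.

Lemma unit_cubeP (x : T3) : unit_cube x <-> in_cube x.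
Proof.
rewrite /unit_cube /unit_square /in_cube /= !in_itv /=.
by split=> [[[]]|[]].
Qed.

Lemma admissible_ae_cube pi : admissible pi -> {ae pi, forall x, in_cube x}.
Proof.
move=> [pi1 _]; apply: filterS (probability1_ae measurable_unit_cube pi1).
by move=> x /unit_cubeP.
Qed.

Lemma measurable_Pr12 : measurable_fun setT (@Pr12 R).
Proof. by apply: measurable_fun_pair; [exact: measurable_x1|exact: measurable_x2]. Qed.

Lemma measurable_Pr13 : measurable_fun setT (@Pr13 R).
Proof. by apply: measurable_fun_pair; [exact: measurable_x1|exact: measurable_x3]. Qed.

Lemma measurable_Pr23 : measurable_fun setT (@Pr23 R).
Proof. by apply: measurable_fun_pair; [exact: measurable_x2|exact: measurable_x3]. Qed.

(** The integral of [pairf n] over the unit square, read off a marginal of one admissible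
    measure. *)
Definition pair_cost n : R := \int[@bxor_prob R]_x pairf n (Pr12 x).

Lemma integrable_comp_pairf pi n (p : T3 -> R * R) : measurable_fun setT p ->
  pi.-integrable setT (EFin \o (pairf n \o p)).
Proof.
move=> mp; apply: (@bounded_integrable _ _ pi _ 1); last by move=> x; exact: pairf_le1.
exact: measurableT_comp (measurable_pairf n) mp.
Qed.

Lemma integral_pairf pi n (p : T3 -> R * R) : measurable_fun setT p ->
  (forall A : set (R * R), measurable A -> pi (p @^-1` A) = leb_square A) ->
  (\int[pi]_x pairf n (p x) = pair_cost n)%R.
Proof.
move=> mp piA; rewrite /pair_cost /Rintegral; congr fine.
have push (P : probability T3 R) (q : T3 -> R * R) (mq : measurable_fun setT q) :
    (\int[P]_x (pairf n (q x))%:E = \int[image_measure P mq]_z (pairf n z)%:E)%E.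
  rewrite integral_pushforward//.
    by apply/measurable_EFinP; exact: measurable_pairf.
  exact: integrable_comp_pairf.
rewrite (push _ _ mp) (push _ _ measurable_Pr12).
apply: eq_measure_integral => A mA _.
rewrite -[LHS]/(pi (p @^-1` A)) (piA A mA); apply/esym.
by have [_ /(_ A mA)[]] := admissible_bxor_prob R.
Qed.

Lemma integrable_gapf pi n : pi.-integrable setT (EFin \o gapf n).
Proof.
apply: (@bounded_integrable _ _ pi _ 3); first exact: measurable_gapf.
by move=> x; apply: gap_le3; exact: centered_itv.
Qed.

Lemma gapf_ge0 n (x : T3) : 0 <= gapf n x.
Proof. by apply: gap_ge0; exact: centered_itv. Qed.

(** All admissible measures give the pair functions the same integral, so their costs differ only
    through the slack. *)
Lemma total_costE pi n : admissible pi ->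
  total_cost pi = (3 * pair_cost n + (\int[pi]_x gapf n x) / 8)%:E.
Proof.
move=> pia; have [_ pi2] := pia.
pose f (x : T3) := pairf n (Pr12 x) + pairf n (Pr13 x) + pairf n (Pr23 x) + gapf n x / 8.
have i12 := integrable_comp_pairf pi n measurable_Pr12.
have i13 := integrable_comp_pairf pi n measurable_Pr13.
have i23 := integrable_comp_pairf pi n measurable_Pr23.
have ig := integrable_gapf pi n.
have ig8 : pi.-integrable setT (EFin \o (fun x => gapf n x / 8)).
  by rewrite /comp; under eq_fun do rewrite EFinM; exact: integrableZr.
have i123 : pi.-integrable setT (EFin \o (fun x => pairf n (Pr12 x) + pairf n (Pr13 x))).
  exact: (integrableD measurableT i12 i13).
have i1234 : pi.-integrable setT
    (EFin \o (fun x => pairf n (Pr12 x) + pairf n (Pr13 x) + pairf n (Pr23 x))).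
  exact: (integrableD measurableT i123 i23).
have if_ : pi.-integrable setT (EFin \o f) := integrableD measurableT i1234 ig8.
have -> : total_cost pi = (\int[pi]_x (f x)%:E)%E.
  apply: ae_eq_integral => //.
  - apply/measurable_EFinP; rewrite /cost.
    apply: measurable_funM; last exact: measurable_x3.
    by apply: measurable_funM; [exact: measurable_x1|exact: measurable_x2].
  - exact: (measurable_int pi).
  - apply: filterS (admissible_ae_cube pia) => x xc _.
    by rewrite (cost_decomposition n xc).
rewrite -[LHS]fineK; last exact: integrable_fin_num.
congr EFin; rewrite -[LHS]/(\int[pi]_x f x)%R /f.
rewrite RintegralD// RintegralD// RintegralD// RintegralZr//.
rewrite !integral_pairf; try by move=> A /pi2[].
- by lra.
- exact: measurable_Pr23.
- exact: measurable_Pr13.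
- exact: measurable_Pr12.
Qed.

Lemma ctri_trif k (x : T3) : in_cube x -> trif k x = ctri k x.
Proof. by move=> [h1 h2 h3]; rewrite /trif /ctri /centered !clamp_id. Qed.

Lemma bxor_prob_ae_trif : {ae (@bxor_prob R), forall x, forall k, 0 <= trif k x}.
Proof.
apply/ae_foralln => k.
have mk : measurable [set x : T3 | 0 <= trif k x].
  rewrite -[X in measurable X]setTI.
  have := @measurable_trif R k => /(_ measurableT `[0, +oo[%classic (measurable_itv _)).
  by congr measurable; apply/seteqP; split => x /=; rewrite in_itv /= andbT.
apply: (probability1_ae mk).
apply: bxor_prob_ae => x y x01 y01 /=.
have /sierpinskiP[xc xt] := sierpinski_bxor x01 y01.
by rewrite ctri_trif.
Qed.

Lemma integral_gapf_le pi n : {ae pi, forall x, forall k, 0 <= trif k x} ->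
  \int[pi]_x gapf n x <= 1 / 8 ^+ n.
Proof.
move=> pit; have ig := integrable_gapf pi n.
rewrite -lee_fin fineK; last exact: integrable_fin_num.
have <- : (\int[pi]_(x in setT) (cst (1 / 8 ^+ n)%:E x) = (1 / 8 ^+ n)%:E)%E.
  rewrite integral_cst// [X in (_ * X)%E](_ : _ = 1%E) ?mule1//.
  exact: (probability_setT pi).
apply: ae_ge0_le_integral => //.
- by move=> x _; rewrite lee_fin gapf_ge0.
- exact: (measurable_int pi).
- by move=> x _; rewrite lee_fin divr_ge0// exprn_ge0.
- apply: filterS pit => x xt _; rewrite lee_fin.
  by apply: gap_le; first [exact: centered_itv|exact: xt].
Qed.

Lemma bxor_prob_gapf_le n : \int[@bxor_prob R]_x gapf n x <= 1 / 8 ^+ n.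
Proof. exact: integral_gapf_le bxor_prob_ae_trif. Qed.

(** At depth [n] every admissible cost is at least [3 * pair_cost n], and this measure exceeds that
    bound by at most [8^-n / 8]. The costs do not depend on [n], which tends to infinity. *)
Lemma bxor_prob_minimizer : minimizer (@bxor_prob R).
Proof.
split; first exact: admissible_bxor_prob.
move=> pi pia.
rewrite (total_costE 0 (admissible_bxor_prob R)) (total_costE 0 pia) lee_fin -subr_le0.
apply: (@geometric_bound_eq0 _ _ 1) => n.
have e1 := total_costE n pia; have e2 := total_costE n (admissible_bxor_prob R).
move: e1 e2; rewrite (total_costE 0 pia) (total_costE 0 (admissible_bxor_prob R)).
move=> [->] [->].
have : 0 <= \int[pi]_x gapf n x by apply: Rintegral_ge0 => x _; exact: gapf_ge0.
have := bxor_prob_gapf_le n.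
have : 1 / 8 ^+ n <= 1 / 2 ^+ n :> R.
  by rewrite !div1r lef_pV2 ?posrE ?exprn_gt0// lerXn2r ?nnegrE//; lra.
have : 0 <= 1 / 8 ^+ n :> R by rewrite divr_ge0// exprn_ge0.
by move: (1 / 8 ^+ n) (1 / 2 ^+ n) => *; lra.
Qed.

Lemma minimizer_gapf_le pi n : minimizer pi -> \int[pi]_x gapf n x <= 1 / 8 ^+ n.
Proof.
move=> [pia pimin]; apply: le_trans (bxor_prob_gapf_le n).
have := pimin _ (admissible_bxor_prob R).
by rewrite (total_costE n (admissible_bxor_prob R)) (total_costE n pia) lee_fin; lra.
Qed.

(** The nonnegative function [|p_k| - p_k] is at most [8^k] times the slack at any depth beyond [k].
    For a minimizer the integral of that bound tends to 0 with the depth, so the function vanishes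
    almost surely. *)
Lemma minimizer_ae_trif pi k : minimizer pi -> {ae pi, forall x, 0 <= trif k x}.
Proof.
move=> pim.
pose f (x : T3) : R := `|trif k x| - trif k x.
have mf : measurable_fun setT f.
  by apply: measurable_funB; [apply: measurableT_comp => //|]; exact: measurable_trif.
have f0 x : 0 <= f x by rewrite subr_ge0 ler_norm.
(* The depth [k + n.+1] exceeds [k], so the [k]-th term occurs in the slack, and it leaves the
   factor [8^-(n+1)] after multiplication by [8^k]. *)
have fg x n : f x <= 8 ^+ k * gapf (k + n.+1) x.
  have := @tri_le_gap _ (k + n.+1) k _ _ _ (centered_itv (x1 x)) (centered_itv (x2 x)) (centered_itv (x3 x)).
  rewrite ler_pdivrMr ?exprn_gt0// mulrC => -> //.
  by rewrite addnS ltnS leq_addr.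
have if_ : pi.-integrable setT (EFin \o f).
  apply: (@bounded_integrable _ _ pi _ (8 ^+ k * 3)) => // x.
  rewrite ger0_norm//; apply: (le_trans (fg x 0)).
  rewrite ler_pM2l ?exprn_gt0//; apply: le_trans (ler_norm _) _.
  by apply: gap_le3; exact: centered_itv.
have If : \int[pi]_x f x <= 0.
  apply: (@geometric_bound_eq0 _ _ 1) => n.
  apply: (@le_trans _ _ (\int[pi]_x (8 ^+ k * gapf (k + n.+1) x))).
    apply: le_Rintegral => //; rewrite /comp.
    by under eq_fun do rewrite EFinM; apply: integrableZl => //; exact: integrable_gapf.
  rewrite RintegralZl//; last exact: integrable_gapf.
  have := minimizer_gapf_le (k + n.+1) pim.
  rewrite -(@ler_pM2l _ (8 ^+ k)) ?exprn_gt0// => /le_trans; apply.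
  have -> : 8 ^+ k * (1 / 8 ^+ (k + n.+1)) = 1 / 8 ^+ n.+1 :> R.
    by rewrite exprD; field; rewrite !expf_neq0.
  rewrite !div1r lef_pV2 ?posrE ?exprn_gt0//.
  apply: (@le_trans _ _ (8 ^+ n)).
    by rewrite lerXn2r ?nnegrE//; lra.
  by rewrite ler_eXn2l//; lra.
have If0 : (\int[pi]_x `|(f x)%:E| = 0)%E.
  under eq_integral do rewrite gee0_abs ?lee_fin//.
  rewrite -[LHS]fineK; last exact: integrable_fin_num.
  congr EFin; apply/le_anti; rewrite If/=.
  by apply: Rintegral_ge0.
have /(ae_eq_integral_abs _ measurableT) : measurable_fun setT (EFin \o f).
  exact/measurable_EFinP.
move=> /(_ pi)[/(_ If0) + _]; apply: filterS => x /(_ Logic.I)[/eqP].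
by rewrite /f subr_eq0 => /eqP <-.
Qed.

Lemma minimizer_ae_sierpinski pi : minimizer pi ->
  {ae pi, forall x, @sierpinski_tetrahedron R x}.
Proof.
move=> pim; have [pia _] := pim.
have : {ae pi, forall x, forall k, 0 <= trif k x}.
  by apply/ae_foralln => k; exact: minimizer_ae_trif.
apply: filterS2 (admissible_ae_cube pia) => x xc xt; apply/sierpinskiP; split => // k.
by rewrite -ctri_trif.
Qed.

End Minimizers.

(** * Uniqueness and support *)

Section Support.
Variable R : realType.
Notation T3 := ((R * R) * R)%type.
Notation mu := (@lebesgue_measure R).
Implicit Types (pi : probability T3 R).

(** A point [c] has at most the two preimages [c / 2] and [(1 + c) / 2] under [sh]. *)
Lemma finite_iter_sh k (c : R) : finite_set [set x | iter k (@sh R) x = c].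
Proof.
elim: k c => [|k IH] c /=; first exact: finite_set1.
apply: (@sub_finite_set _ _ ([set x | iter k (@sh R) x = c / 2] `|`
  [set x | iter k (@sh R) x = (1 + c) / 2])); last by rewrite finite_setU.
move=> x /= xc; have := shE (iter k (@sh R) x).
by rewrite xc; case: (dg _) => /= ->; [right|left; rewrite add0r].
Qed.

Lemma countable_dyadic : countable [set x : R | ~ nondyadic x].
Proof.
rewrite (_ : [set x | _] = \bigcup_k [set x | iter k (@sh R) x = 1 / 2]).
  by apply: bigcup_countable => // k _; apply: finite_set_countable; exact: finite_iter_sh.
apply/seteqP; split => [x /= /existsNP[k /negP]|x [k _ /= xk] /(_ k)].
  by rewrite negbK => /eqP ?; exists k.
by rewrite xk eqxx.
Qed.

Lemma admissible_Pr12 pi (A : set (R * R)) : admissible pi -> measurable A ->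
  pi (@Pr12 R @^-1` A) = leb_square A.
Proof. by move=> [_ pi2] /pi2[]. Qed.

(** Dyadic points are countable, so the strips above them are null for the marginal on the first two
    coordinates. *)
Lemma admissible_ae_nondyadic pi : admissible pi ->
  {ae pi, forall x, nondyadic (x1 x) /\ nondyadic (x2 x)}.
Proof.
move=> pia.
pose N := [set x : R | ~ nondyadic x].
have mN : measurable N by apply: countable_measurable => //; exact: countable_dyadic.
have muN : mu N = 0%E by apply: countable_lebesgue_measure0; exact: countable_dyadic.
have mNT : measurable (N `*` [set: R]) by exact: measurableX.
have mTN : measurable ([set: R] `*` N) by exact: measurableX.
have le0 (A : set (R * R)) : measurable A -> (mu \x mu)%E A = 0%E ->
    pi (@Pr12 R @^-1` A) = 0%E.
  move=> mA A0; rewrite (admissible_Pr12 pia mA); apply/eqP; rewrite eq_le measure_ge0 andbT -A0.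
  apply: le_measure; rewrite ?inE//; apply: measurableI => //; exact: measurable_unit_square.
have ae1 : {ae pi, forall x, nondyadic (x1 x)}.
  exists (@Pr12 R @^-1` (N `*` [set: R])); split.
  - by rewrite -[X in measurable X]setTI; exact: measurable_Pr12.
  - by apply: le0 => //; rewrite product_measure1E// [X in (X * _)%E]muN mul0e.
  - by move=> x.
have ae2 : {ae pi, forall x, nondyadic (x2 x)}.
  exists (@Pr12 R @^-1` ([set: R] `*` N)); split.
  - by rewrite -[X in measurable X]setTI; exact: measurable_Pr12.
  - by apply: le0 => //; rewrite product_measure1E// [X in (_ * X)%E]muN mule0.
  - by move=> x.
by apply: filterS2 ae1 ae2.
Qed.

(** Almost every point is the graph point above its first two coordinates, so the measure is
    recovered from its prescribed first marginal. *)
Lemma minimizer_bxor_prob pi (A : set T3) : minimizer pi -> measurable A ->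
  pi A = @bxor_prob R A.
Proof.
move=> pim mA; have [pia _] := pim.
have mB : measurable (@bxor_graph R @^-1` A).
  rewrite -[X in measurable X]setTI; exact: measurable_bxor_graph.
have mC : measurable (@Pr12 R @^-1` (@bxor_graph R @^-1` A)).
  rewrite -[X in measurable X]setTI; exact: measurable_Pr12.
have xE : {ae pi, forall x, bxor_graph (Pr12 x) = x}.
  apply: filterS2 (minimizer_ae_sierpinski pim) (admissible_ae_nondyadic pia).
  move=> [[a b] c] /sierpinski_graph h [n1 n2].
  by rewrite /bxor_graph /= -h.
rewrite bxor_probE -[RHS](admissible_Pr12 pia mB).
apply/le_anti/andP; split; apply: ae_le_measure => //.
  by apply: filterS xE => x /= ->.
by apply: filterS xE => x /= ->.
Qed.

(** * Open sets, closedness of the tetrahedron, and the support *)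

Lemma open_box (U : set T3) (x : T3) : open U -> U x ->
  exists2 e : R, 0 < e & forall y : T3, `|x1 x - x1 y| < e -> `|x2 x - x2 y| < e ->
    `|x3 x - x3 y| < e -> U y.
Proof.
move=> oU Ux; have /nbhs_ballP[e e0 eU] : nbhs x U by exact: open_nbhs_nbhs.
exists e => // y h1 h2 h3; apply: eU; split; [split|] => /=;
rewrite -ball_normE; [exact: h1|exact: h2|exact: h3].
Qed.

(** The sigma-algebra is a product one, so an open set is written as the countable union of the
    rational boxes it contains. *)
Lemma open_measurable3 (U : set T3) : open U -> measurable U.
Proof.
move=> oU.
pose box (q : rat * rat * rat * rat) : set T3 :=
  (`](ratr q.1.1.1 - ratr q.2), (ratr q.1.1.1 + ratr q.2)[ `*`
   `](ratr q.1.1.2 - ratr q.2), (ratr q.1.1.2 + ratr q.2)[) `*`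
   `](ratr q.1.2 - ratr q.2), (ratr q.1.2 + ratr q.2)[.
have mbox q : measurable (box q).
  by apply: measurableX; [apply: measurableX|]; exact: measurable_itv.
pose F q : set T3 := if pselect (box q `<=` U) then box q else set0.
have mF q : measurable (F q).
  by rewrite /F; case: pselect => qU; [exact: mbox|exact: measurable0].
rewrite (_ : U = \bigcup_q F q); first exact: countable_bigcupT_measurable.
apply/seteqP; split => [x Ux|x [q _]]; last first.
  by rewrite /F; case: pselect => // qU; exact: qU.
have [e e0 eU] := open_box oU Ux.
(* Radius below [e / 2]: a box centered within [r] of [x] stays within [2r < e] of [x]. *)
have [r] : exists q, ratr q \in `]0, (e / 2)[%R by apply: rat_in_itvoo; lra.
rewrite in_itv /= => /andP[r0 re].
have near_rat (t : R) : exists q, t - ratr r < ratr q < t + ratr r.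
  have [q] : exists q, ratr q \in `](t - ratr r), (t + ratr r)[%R by apply: rat_in_itvoo; lra.
  by rewrite in_itv /= => ?; exists q.
have [a /andP[a1 a2]] := near_rat (x1 x).
have [b /andP[b1 b2]] := near_rat (x2 x).
have [c /andP[c1 c2]] := near_rat (x3 x).
exists (a, b, c, r) => //; rewrite /F; case: pselect => [qU|].
  split; [split|]; rewrite /= in_itv /=; move: a1 a2 b1 b2 c1 c2; rewrite /x1 /x2 /x3 => *;
  by apply/andP; split; lra.
case=> -[[y1 y2] y3] [[]] /=; rewrite !in_itv /= => /andP[? ?] /andP[? ?] /andP[? ?].
by apply: eU; rewrite ltr_norml; move: a1 a2 b1 b2 c1 c2; rewrite /x1 /x2 /x3 /= => *;
  apply/andP; split; lra.
Qed.

Lemma continuous_tau : continuous (@tau R).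
Proof.
move=> a; apply: cvgB; last exact: cvg_cst.
by apply: cvgM; [exact: cvg_cst|exact: norm_continuous].
Qed.

Lemma continuous_x1 : continuous (@x1 R).
Proof. by move=> x; apply: (@continuous_comp _ _ _ fst fst x); exact: cvg_fst. Qed.

Lemma continuous_x2 : continuous (@x2 R).
Proof.
by move=> x; apply: (@continuous_comp _ _ _ fst snd x); [exact: cvg_fst|exact: cvg_snd].
Qed.

Lemma continuous_x3 : continuous (@x3 R).
Proof. by move=> x; exact: cvg_snd. Qed.

Lemma continuous_ctri k : continuous (@ctri R k).
Proof.
have h (f : T3 -> R) : continuous f -> continuous (fun x => iter k (@tau R) (1 - 2 * f x)).
  move=> cf; elim: (k) => [|j IH] x /=.
    by apply: cvgB; [exact: cvg_cst|apply: cvgM; [exact: cvg_cst|exact: cf]].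
  exact: (continuous_comp (IH x) (@continuous_tau _)).
have c1 := continuous_x1; have c2 := continuous_x2; have c3 := continuous_x3.
move=> x; apply: cvgM; last exact: h.
by apply: cvgM; exact: h.
Qed.

(** [sierpinskiP] replaces the existence of digits by closed conditions on continuous functions. *)
Lemma closed_sierpinski : closed (@sierpinski_tetrahedron R).
Proof.
have c1 : continuous (@x1 R) := continuous_x1.
have c2 : continuous (@x2 R) := continuous_x2.
have c3 : continuous (@x3 R) := continuous_x3.
have h (f : T3 -> R) : continuous f -> closed [set x | 0 <= f x <= 1].
  move=> cf; rewrite (_ : [set x | _] = f @^-1` `[0, 1]%classic).
    by apply: preimage_closed; [by move=> x _; exact: cf|exact: interval_closed].
  by apply/seteqP; split => x /=; rewrite in_itv.
rewrite (_ : @sierpinski_tetrahedron R =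
    ([set x | 0 <= x1 x <= 1] `&` [set x | 0 <= x2 x <= 1] `&` [set x | 0 <= x3 x <= 1]) `&`
    \bigcap_k [set x | 0 <= ctri k x]).
  apply: closedI; first by apply: closedI; [apply: closedI|]; exact: h.
  apply: closed_bigI => k _.
  rewrite (_ : [set x | _] = ctri k @^-1` [set t | 0 <= t])//.
  by apply: preimage_closed; [by move=> x _; exact: continuous_ctri|exact: closed_ge].
apply/seteqP; split => x.
  by move=> /sierpinskiP[[h1 h2 h3] xt]; split; [split; [split|]|move=> k _; exact: xt].
move=> [[[h1 h2] h3] xt]; apply/sierpinskiP; split; first by split.
by move=> k; exact: xt.
Qed.

(** The complement of the tetrahedron is open and null. Conversely, near a point of it, prescribing
    enough digits of the first two coordinates is an event of positive mass, and it almost surely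
    forces the same digits of the third. *)
Lemma minimizer_support pi : minimizer pi ->
  measure_support pi = @sierpinski_tetrahedron R.
Proof.
move=> pim; have [pia _] := pim.
have piS := minimizer_ae_sierpinski pim.
apply/seteqP; split => x.
  move=> xsupp; apply: contrapT => nSx.
  have oS : open (~` @sierpinski_tetrahedron R) by apply: closed_openC; exact: closed_sierpinski.
  have := xsupp _ oS nSx.
  have [N [mN N0 SN]] := piS.
  rewrite (_ : pi _ = 0%E) ?ltxx//.
  apply/eqP; rewrite eq_le measure_ge0 andbT -N0.
  by apply: le_measure; rewrite ?inE//; exact: open_measurable3.
move=> [b1 [b2 [b3 [/binary_expansionP e1 /binary_expansionP e2 /binary_expansionP e3 b]]]].
move=> U oU Ux; have [e e0 eU] := open_box oU Ux.
have [n ne] : exists n, 1 / 2 ^+ n < e.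
  apply: contrapT => /forallNP H; suff : e <= 0 by lra.
  apply: (@geometric_bound_eq0 _ _ 1) => n.
  by rewrite leNgt; apply/negP; exact: H.
have [l1 [r1 [l10 lr1 r11 d1]]] := dig_box R n b1.
have [l2 [r2 [l20 lr2 r21 d2]]] := dig_box R n b2.
pose V : set (R * R) := `]l1, r1[%classic `*` `]l2, r2[%classic.
have mV : measurable V by apply: measurableX; exact: measurable_itv.
have mPV : measurable (@Pr12 R @^-1` V).
  rewrite -[X in measurable X]setTI; exact: measurable_Pr12.
have V0 : (0 < leb_square V)%E.
  rewrite leb_square_box; try exact: measurable_itv.
  - rewrite !lebesgue_measure_itv /= !lte_fin lr1 lr2 -!EFinB -EFinM lte_fin.
    by rewrite mulr_gt0// subr_gt0.
  - by move=> t /=; rewrite !in_itv /= => /andP[? ?]; apply/andP; split; lra.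
  - by move=> t /=; rewrite !in_itv /= => /andP[? ?]; apply/andP; split; lra.
rewrite -(admissible_Pr12 pia mV) in V0.
apply: (lt_le_trans V0); apply: ae_le_measure => //; first exact: open_measurable3.
apply: filterS2 piS (admissible_ae_nondyadic pia).
move=> y yS [n1 n2] [/= ]; rewrite !in_itv /= => y1 y2.
have close (t : R) (u : nat -> bool) : (forall k, (k < n)%N -> dig t k = u k) ->
    0 <= t <= 1 -> `|bval R u - t| < e.
  move=> tu t01; apply: le_lt_trans ne; rewrite -{1}(bval_dig t01).
  by apply: bval_close => k kn; rewrite tu.
have /sierpinskiP[[yc1 yc2 yc3] _] := yS.
apply: eU.
- by rewrite e1; apply: close => //; exact: d1.
- by rewrite e2; apply: close => //; exact: d2.
(* The third coordinate of [y] is the bitwise sum of the first two, so its first [n] digits are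
   those of [b3]. *)
rewrite e3 (sierpinski_graph yS n1 n2); apply: le_lt_trans ne.
apply: bval_close => k kn; rewrite d1// d2//.
by move: (b k); case: (b1 k) (b2 k) (b3 k) => [] [] [].
Qed.

End Support.

Theorem mainTheorem17 (R : realType) :
  (exists pi : probability ((R * R) * R)%type R, minimizer pi) /\
  (forall pi pi' : probability ((R * R) * R)%type R,
     minimizer pi -> minimizer pi' ->
     forall A : set ((R * R) * R)%type, measurable A -> pi A = pi' A) /\
  (forall pi : probability ((R * R) * R)%type R,
     minimizer pi -> measure_support pi = @sierpinski_tetrahedron R).
Proof.
split; first by exists (@bxor_prob R); exact: bxor_prob_minimizer.
split=> [pi pi' pim pim' A mA|pi]; last exact: minimizer_support.
by rewrite !minimizer_bxor_prob.
Qed.
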